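(* Let $n\geq 2$ be an integer, let $|\cdot|$ be an arbitrary norm on $\mathbb R^n$ induced by an inner product, and let $\varphi=\frac{1+\sqrt5}{2}$. For every $\alpha\in\mathbb R^n\setminus\mathbb Q^n$ one has $$g_n(\alpha)\geq\varphi^{1/2^{n-1}},$$ where $g_n(\alpha)=\liminf_{m\to\infty}(q_m)^{1/m}$ and $(q_m)_{m\ge1}$ is the sequence of denominators of simultaneous best approximations to $\alpha$ with respect to $|\cdot|$. Consequently, $$G(n):=\inf_{\alpha\in\mathbb R^n\setminus\mathbb Q^n}g_n(\alpha)\geq\varphi^{1/2^{n-1}}.$$
   Context: The norm is $|x|=\sqrt{\langle x,x\rangle}$ for an arbitrary inner product $\langle\cdot,\cdot\rangle$ on $\mathbb R^n$. For $\alpha\in\mathbb R^n\setminus\mathbb Q^n$ and a positive integer $q$, set $\delta_q=\min_{\mathbf p\in\mathbb Z^n}|q\alpha-\mathbf p|$. The denominators of best approximations are the increasing (infinite) sequence $1=q_1<q_2<q_3<\cdots$ consisting of all positive integers $q$ such that $\delta_t>\delta_q$ for every integer $t$ with $0<t<q$. *)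

(* Defs.v *)
From HB Require Import structures.
From mathcomp Require Import all_boot all_order all_algebra.
From mathcomp Require Import zify lra.
From mathcomp Require Import all_classical all_reals all_analysis.
Import Order.TTheory GRing.Theory Num.Theory.

Set Implicit Arguments.
Unset Strict Implicit.
Unset Printing Implicit Defensive.

Local Open Scope classical_set_scope.
Local Open Scope ring_scope.

(* [{dot 'rV[R]_n for idfun}] is MathComp's type of positive definite
   symmetric bilinear forms, i.e., of inner products, on R^n. *)

Definition dotnorm (R : realType) (n : nat) (dot : {dot 'rV[R]_n for idfun})
    (x : 'rV[R]_n) : R :=
  Num.sqrt (dot x x).

Definition rational_rV (R : realType) (n : nat) : set 'rV[R]_n :=
  [set alpha | forall i, rational (alpha 0 i)].

Definition intvec (R : realType) (n : nat) (p : 'rV[int]_n) : 'rV[R]_n :=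
  map_mx intr p.

(* The infimum is attained: see [delta_min] below. *)
Definition delta (R : realType) (n : nat) (dot : {dot 'rV[R]_n for idfun})
    (alpha : 'rV[R]_n) (q : nat) : R :=
  inf [set dotnorm dot (q%:R *: alpha - intvec R p) | p in [set: 'rV[int]_n]].

Definition best_denominator (R : realType) (n : nat)
    (dot : {dot 'rV[R]_n for idfun}) (alpha : 'rV[R]_n) : set nat :=
  [set q | (0 < q)%N /\
    forall t, (0 < t < q)%N -> delta dot alpha q < delta dot alpha t].

Definition is_least (A : set nat) (q : nat) : Prop :=
  A q /\ forall t, A t -> (q <= t)%N.

(* [bestq dot alpha m] is q_m for m >= 1; the value q_0 = 0 is a convention
   that only serves to start the recursion "q_(m+1) is the least best
   denominator exceeding q_m". The default 0 of [xget] is never used when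
   alpha has an irrational coordinate: see [bestq_increasing] and
   [bestq_range] below. *)
Fixpoint bestq (R : realType) (n : nat) (dot : {dot 'rV[R]_n for idfun})
    (alpha : 'rV[R]_n) (m : nat) : nat :=
  if m is k.+1 then
    xget 0%N [set q | is_least
      [set t | best_denominator dot alpha t /\ (bestq dot alpha k < t)%N] q]
  else 0%N.

(* The lower limit may a priori be infinite, hence the extended reals. *)
Definition growth (R : realType) (n : nat) (dot : {dot 'rV[R]_n for idfun})
    (alpha : 'rV[R]_n) : \bar R :=
  limn_einf (fun m => ((bestq dot alpha m)%:R `^ (m%:R^-1))%:E).

Definition min_growth (R : realType) (n : nat)
    (dot : {dot 'rV[R]_n for idfun}) : \bar R :=
  ereal_inf [set growth dot alpha | alpha in ~` @rational_rV R n].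

Definition golden_ratio (R : realType) : R := (1 + Num.sqrt 5) / 2.

Section WellDefined.
Variables (R : realType) (n : nat) (dot : {dot 'rV[R]_n for idfun}).
Implicit Types (x y alpha : 'rV[R]_n).

Let dotC x y : dot x y = dot y x.
Proof. by rewrite (@hermitian_subproof _ _ _ _ dot x y) expr0 mul1r. Qed.

Let dot_gt0 x : x != 0 -> 0 < dot x x.
Proof. exact: (@neq0_dnorm_gt0 R _ idfun dot). Qed.

Let dotDl x y z : dot (x + y) z = dot x z + dot y z.
Proof. by rewrite linearDl. Qed.

Let dotZl a x z : dot (a *: x) z = a * dot x z.
Proof. exact: (@linearZl_LR R _ _ _ _ _ dot). Qed.

Let dotDr x y z : dot z (x + y) = dot z x + dot z y.
Proof. by rewrite !(dotC z) dotDl. Qed.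

Let dotZr a x z : dot z (a *: x) = a * dot z x.
Proof. by rewrite !(dotC z) dotZl. Qed.

Let dot0l x : dot 0 x = 0.
Proof. by rewrite -(scale0r 0) dotZl mul0r. Qed.

Let dot_suml (I : Type) (r : seq I) (P : pred I) (F : I -> 'rV[R]_n) z :
  dot (\sum_(i <- r | P i) F i) z = \sum_(i <- r | P i) dot (F i) z.
Proof.
by elim/big_rec2: _ => [|i a b _ <-]; rewrite ?dot0l// dotDl.
Qed.

Let dot_ge0 x : 0 <= dot x x.
Proof. by have [->|/dot_gt0/ltW//] := eqVneq x 0; rewrite dot0l. Qed.

Let CS x y : dot x y ^+ 2 <= dot x x * dot y y.
Proof.
have [->|y0] := eqVneq y 0; first by rewrite dotC !dot0l expr0n mulr0.
have y_gt0 := dot_gt0 y0.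
have := dot_ge0 (dot y y *: x + (- dot x y) *: y).
rewrite !(dotDl, dotDr, dotZl, dotZr) (dotC y x).
set a := dot y y in y_gt0 *; set b := dot x y; set c := dot x x => h.
have : 0 <= a * (a * c - b ^+ 2) by apply: le_trans h _; lra.
by rewrite pmulr_rge0// subr_ge0 mulrC.
Qed.

Let G : 'M[R]_n := \matrix_(i, j) dot 'e_i 'e_j.

Let dotG x j : dot x 'e_j = (x *m G) 0 j.
Proof.
rewrite {1}(row_sum_delta x) dot_suml mxE.
by apply: eq_bigr => i _; rewrite dotZl mxE.
Qed.

Let dotE x y : dot x y = (x *m G *m y^T) 0 0.
Proof.
rewrite {1}(row_sum_delta y) dotC dot_suml [RHS]mxE.
by apply: eq_bigr => i _; rewrite dotZl dotC dotG [y^T _ _]mxE mulrC.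
Qed.

Let Gunit : G \in unitmx.
Proof.
rewrite -row_free_unit; apply: inj_row_free => v vG; apply/eqP.
apply: contraT => /dot_gt0; rewrite dotE vG mul0mx mxE ltxx//.
Qed.

Let coord_bound : exists2 C : R, 0 < C &
  forall x i, `|x 0 i| <= C * dotnorm dot x.
Proof.
pose v i : 'rV[R]_n := 'e_i *m invmx G.
have vE x i : dot (v i) x = x 0 i.
  by rewrite dotE mulmxKV// -rowE !mxE.
exists (1 + \sum_i dotnorm dot (v i)).
  by rewrite ltr_pwDl// sumr_ge0// => i _; exact: sqrtr_ge0.
move=> x i; apply: (@le_trans _ _ (dotnorm dot (v i) * dotnorm dot x)).
  rewrite -vE -sqrtr_sqr /dotnorm -sqrtrM ?dot_ge0// ler_sqrt ?CS//.
  by rewrite mulr_ge0.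
rewrite ler_wpM2r ?sqrtr_ge0// (bigD1 i)//= addrCA lerDl addr_ge0//.
by rewrite sumr_ge0// => j _; exact: sqrtr_ge0.
Qed.

Let norm_bound : exists2 K : R, 0 < K &
  forall x e, 0 <= e -> (forall i, `|x 0 i| <= e) -> dotnorm dot x <= K * e.
Proof.
pose S := 1 + \sum_i \sum_j `|G j i|.
have S_gt0 : 0 < S.
  by rewrite ltr_pwDl// sumr_ge0// => i _; rewrite sumr_ge0.
exists (Num.sqrt S); first by rewrite sqrtr_gt0.
move=> x e e0 xe.
suff h : dot x x <= S * e ^+ 2.
  rewrite -(ger0_norm e0) -sqrtr_sqr -sqrtrM ?(ltW S_gt0)// ler_sqrt//.
  by rewrite mulr_ge0 ?sqr_ge0// ltW.
rewrite dotE mxE (le_trans (ler_norm _))// (le_trans (ler_norm_sum _ _ _))//.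
rewrite mulrDl mul1r ler_wpDl ?sqr_ge0// mulr_suml ler_sum// => i _.
rewrite normrM [x^T _ _]mxE mxE mulr_suml.
apply: (@le_trans _ _ ((\sum_j `|G j i| * e) * e)).
  rewrite ler_pM// (le_trans (ler_norm_sum _ _ _))// ler_sum// => j _.
  by rewrite normrM mulrC ler_wpM2l.
by rewrite mulr_suml ler_sum// => j _; rewrite expr2 mulrA.
Qed.

Lemma delta_min alpha q :
  (exists p, delta dot alpha q = dotnorm dot (q%:R *: alpha - intvec R p)) /\
  (forall p, delta dot alpha q <= dotnorm dot (q%:R *: alpha - intvec R p)).
Proof.
set N := fun p => dotnorm dot (q%:R *: alpha - intvec R p).
have lb : has_lbound [set N p | p in [set: 'rV[int]_n]].
  by exists 0 => _ [p _ <-]; exact: sqrtr_ge0.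
have dle p : delta dot alpha q <= N p by apply: ge_inf => //; exists p.
split=> //.
have [C C0 hC] := coord_bound.
pose B := Num.bound (C * N 0 + \sum_i `|q%:R * alpha 0 i|).
pose P (f : {ffun 'I_n -> 'I_(2 * B).+1}) : 'rV[int]_n :=
  \row_i ((f i)%:Z - B%:Z).
have PE p : N p <= N 0 -> exists f, p = P f.
  move=> pN.
  have hp (i : 'I_n) : `|p 0 i| <= B%:Z :> int.
    rewrite -(ler_int R) intr_norm.
    apply: (@le_trans _ _ (C * N 0 + \sum_i `|q%:R * alpha 0 i|)); last first.
      rewrite ltW// -[B%:~R]/(B%:R) /B archi_boundP// addr_ge0 ?sumr_ge0//.
      by rewrite mulr_ge0 ?sqrtr_ge0// ltW.
    have -> : (p 0 i)%:~R =
        q%:R * alpha 0 i - (q%:R *: alpha - intvec R p) 0 i :> R.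
      by rewrite !mxE; lra.
    rewrite (le_trans (ler_normB _ _))// addrC lerD//.
      by rewrite (le_trans (hC _ _))// ler_wpM2l// ltW.
    by rewrite (bigD1 i)//= lerDl sumr_ge0.
  exists [ffun i : 'I_n => inord (absz (p 0 i + B%:Z))]; apply/rowP => i.
  by rewrite !mxE ffunE inordK; move: (hp i); lia.
have [f _ fmin] := @arg_minP _ _ _ [ffun=> inord B] predT (N \o P) isT.
have P0 : P [ffun=> inord B] = 0.
  by apply/rowP => i; rewrite !mxE ffunE inordK ?subrr//; lia.
exists (P f); apply/eqP; rewrite eq_le dle /=.
apply: lb_le_inf; first by exists (N 0), 0.
move=> _ [p _ <-]; have [pN|/ltW Np] := leP (N p) (N 0).
  by have [g ->] := PE p pN; exact: fmin.
by apply: le_trans Np; rewrite -P0; exact: fmin.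
Qed.

Let delta_gt0 alpha q : ~ rational_rV alpha -> (0 < q)%N ->
  0 < delta dot alpha q.
Proof.
move=> irr q0; have [[p ->] _] := delta_min alpha q.
rewrite /dotnorm sqrtr_gt0 dot_gt0//; apply/eqP => /rowP pE.
apply: irr => i; apply/rationalP; exists (p 0 i), q.
have := pE i; rewrite !mxE => /eqP; rewrite subr_eq0 => /eqP <-.
by rewrite mulrC mulKf// pnatr_eq0; lia.
Qed.

Let dirichlet alpha (e : R) : 0 < e ->
  exists2 q, (0 < q)%N & delta dot alpha q < e.
Proof.
move=> e0; have [K K0 hK] := norm_bound.
pose M := (Num.bound (K / e)).+1.
have M0 : 0 < M%:R :> R by rewrite ltr0n.
have KM : K / M%:R < e.
  rewrite ltr_pdivrMr// mulrC -ltr_pdivrMr//.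
  apply: lt_trans (archi_boundP _) _; first by rewrite divr_ge0// ltW.
  by rewrite ltr_nat.
pose fr (q : nat) i : R := q%:R * alpha 0 i - (Num.floor (q%:R * alpha 0 i))%:~R.
have fr_ge0 q i : 0 <= fr q i by rewrite subr_ge0 floor_le.
have fr_lt1 q i : fr q i < 1.
  by rewrite ltrBlDr addrC; have := floorD1_gt (q%:R * alpha 0 i); rewrite intrD.
have tr_le q i : (Num.truncn (M%:R * fr q i) < M)%N.
  rewrite -(ltr_nat R); apply: (@le_lt_trans _ _ (M%:R * fr q i)).
    by rewrite truncn_le mulr_ge0// ltW.
  by rewrite gtr_pMr.
pose T := {ffun 'I_n -> 'I_M}.
pose F (q : 'I_#|T|.+1) : T := [ffun i : 'I_n => inord (Num.truncn (M%:R * fr q i))].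
have /injectivePn[a [b ab Fab]] : ~~ injectiveb F.
  by apply/negP => /injectiveP/leq_card; rewrite card_ord ltnn.
wlog ltab : a b ab Fab / (a < b)%N.
  move=> h; have : (a < b)%N || (b < a)%N by move: ab; rewrite -val_eqE/=; lia.
  by case/orP => [/(h a b)|/(h b a)]; apply=> //; rewrite eq_sym.
exists (b - a)%N; first by rewrite subn_gt0.
pose p : 'rV[int]_n := \row_i
  (Num.floor (b%:R * alpha 0 i) - Num.floor (a%:R * alpha 0 i)).
apply: le_lt_trans ((delta_min alpha (b - a)%N).2 p) _.
apply: le_lt_trans KM; apply: hK; first by rewrite invr_ge0 ltW.
move=> i.
have -> : ((b - a)%N%:R *: alpha - intvec R p) 0 i = fr b i - fr a i.
  by rewrite !mxE /fr natrB ?(ltnW ltab)// intrB; lra.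
have := congr1 (fun f : T => val (f i)) Fab; rewrite !ffunE/= !inordK// => tE.
have Mfr q : 0 <= M%:R * fr q i by rewrite mulr_ge0// ltW.
have /andP[a1 a2] := truncn_itv (Mfr a).
have /andP[b1 b2] := truncn_itv (Mfr b).
rewrite tE -natr1 in a1 a2; rewrite -natr1 in b2.
rewrite -[leRHS]mul1r ler_pdivlMr// -[M%:R]gtr0_norm// -normrM ler_norml.
by apply/andP; split; lra.
Qed.

Let best_above alpha k : ~ rational_rV alpha ->
  exists t, best_denominator dot alpha t /\ (k < t)%N.
Proof.
move=> irr.
have [e e0 he] : exists2 e : R, 0 < e &
    forall t, (0 < t <= k)%N -> e <= delta dot alpha t.
  elim: k => [|k [e e0 he]]; first by exists 1 => // t; lia.
  exists (Num.min e (delta dot alpha k.+1)).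
    by rewrite lt_min e0 delta_gt0.
  move=> t tk; rewrite ge_min; have [->|tk1] := eqVneq t k.+1.
    by rewrite lexx orbT.
  by rewrite he//; lia.
have [q q0 qe] := dirichlet alpha e0.
have ex : exists q, (0 < q)%N && (delta dot alpha q < e).
  by exists q; rewrite q0.
case: (ex_minnP ex) => m /andP[m0 me] mmin; exists m; split.
  split=> // t /andP[t0 tm]; apply: lt_le_trans me _; rewrite leNgt.
  by apply/negP => te; have := mmin t; rewrite t0 te => /(_ isT); lia.
rewrite ltnNge; apply/negP => mk.
by have := he m; rewrite m0 mk leNgt me => /(_ isT).
Qed.

Let bestqS alpha m : ~ rational_rV alpha ->
  is_least [set t | best_denominator dot alpha t /\ (bestq dot alpha m < t)%N]
    (bestq dot alpha m.+1).
Proof.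
move=> irr /=.
have [t0 t0P] := best_above (bestq dot alpha m) irr.
have ex : exists t,
    `[< best_denominator dot alpha t /\ (bestq dot alpha m < t)%N >].
  by exists t0; apply/asboolP.
apply: xgetPex; case: (ex_minnP ex) => q /asboolP qP qmin.
by exists q; split => // t tP; apply: qmin; apply/asboolP.
Qed.

Lemma bestq_increasing alpha : ~ rational_rV alpha ->
  {homo bestq dot alpha : k m / (k < m)%N}.
Proof.
move=> irr; apply: homo_ltn => [?|m]; first exact: ltn_trans.
by have [[]] := bestqS m irr.
Qed.

Lemma bestq_range alpha : ~ rational_rV alpha ->
  [set bestq dot alpha m | m in [set m | (0 < m)%N]] =
  best_denominator dot alpha.
Proof.
move=> irr; apply/seteqP; split=> [_ [[//|m] _ <-]|q qP].
  by have [[]] := bestqS m irr.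
have ex : exists m, (q <= bestq dot alpha m)%N.
  exists q; elim: {qP}q => // q /leq_ltn_trans; apply.
  exact: bestq_increasing.
case: (ex_minnP ex) => -[|m] qm mmin; first by case: qP; move: qm => /=; lia.
exists m.+1 => //; apply/eqP; rewrite eqn_leq qm andbT.
have [_] := bestqS m irr; apply; split=> //.
by rewrite ltnNge; apply/negP => /mmin; rewrite ltnn.
Qed.

End WellDefined.

(* Main.v *)
From HB Require Import structures.
Require Import Defs.
From mathcomp Require Import all_boot all_order all_algebra.
From mathcomp Require Import zify lra.
From mathcomp Require Import all_classical all_reals all_analysis.
Import Order.TTheory GRing.Theory Num.Theory.
Local Open Scope classical_set_scope.
Local Open Scope ring_scope.

(** Write N = 2^(n-1), q_m for the best denominators, and X_m = (q_m, p_m) in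
    Z^(n+1) for a lattice point whose remainder xi_m = q_m alpha - p_m has the
    least norm for its denominator. The heart of the proof is that, for every
    m >= 1,
      q_(m+2N) >= q_(m+N) + q_m   or   q_(m+2N) >= 3 q_m
    ([bestq_recurrence]). Since phi^2 = phi + 1 <= 3, induction then gives
    q_m >= c lambda^m with lambda^N = phi ([fibonacci_growth]), and the
    constant c disappears in the lower limit of the m-th roots
    ([root_growth]).

    The dichotomy comes from the classes of X_m, ..., X_(m+2N) in the group
    Z^(n+1) / 2 Z^(n+1), which has 4N elements. None is zero, since a best
    approximation cannot be halved ([parity_neq0]). If two coincide, half the
    difference of the two points has a remainder shorter than that of the
    first one, which forces q_j >= 3 q_i ([parity_eq_ge3]). Otherwise there
    are 2N+1 distinct nonzero classes. More than half of the group cannot be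
    sum-free, so three of them form, together with 0, a subgroup V of order 4.
    The last N+1 classes collide modulo V, which has only N cosets. Hence
    some X_i + X_j + X_k is divisible by 2 with i < j < k, j and k both among
    the last N+1 indices ([upper_zero_sum_triple]). Now the Euclidean structure
    is used: for W = (X_i + X_j + X_k) / 2 the squared remainders of W,
    W - X_i, W - X_j, W - X_k add up to those of X_i, X_j, X_k
    ([sqdist_half_sum]). If q_(m+2N) < q_(m+N) + q_m, then q_k - q_j < q_i, so
    W - X_i has a denominator below q_k, and W - X_j, W - X_k have nonzero
    ones below q_i in absolute value; minimality makes the left-hand side
    exceed |xi_k|^2 + 2 |xi_i|^2, a contradiction ([parity_sum_neq0]). *)

Set Implicit Arguments.
Unset Strict Implicit.
Unset Printing Implicit Defensive.

(** * Lattice points modulo 2 *)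

(** A product of finite additive groups is one as well. *)
HB.instance Definition _ (A B : finZmodType) := GRing.Zmodule.on (A * B)%type.

Section ParityClasses.
Variable n : nat.
Implicit Types X Y : int * 'rV[int]_n.

(** The class modulo 2 of the lattice point (q, p) of Z x Z^n. *)
Definition parity X : 'F_2 * 'rV['F_2]_n := (X.1%:~R, map_mx intr X.2).

Lemma parityD X Y : parity (X + Y) = parity X + parity Y.
Proof. by congr pair; rewrite ?rmorphD ?map_mxD. Qed.

Lemma F2_addrr (x : 'F_2) : x + x = 0.
Proof. by rewrite -mulr2n -mulr_natl pchar_Fp_0 // mul0r. Qed.

Lemma parity_addrr (c : 'F_2 * 'rV['F_2]_n) : c + c = 0.
Proof.
case: c => a v; congr pair; first exact: F2_addrr.
by apply/rowP => i; rewrite !mxE; exact: F2_addrr.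
Qed.

Lemma intr_F2_eq0 (z : int) : z%:~R = 0 :> 'F_2 -> exists w, z = w + w.
Proof.
move=> z0; exists (z %/ 2)%Z.
have zE := divz_eq z 2.
have : ((z %% 2)%Z)%:~R = 0 :> 'F_2.
  move: z0; rewrite {1}zE rmorphD rmorphM /=.
  have -> : 2%:~R = 0 :> 'F_2 by exact/val_inj.
  by rewrite mulr0 add0r.
have m0 : 0 <= (z %% 2)%Z by exact: modz_ge0.
have m2 : (z %% 2)%Z < 2 by exact: ltz_pmod.
have : (z %% 2)%Z = 0 \/ (z %% 2)%Z = 1 by lia.
case=> r; rewrite r // => _; move: zE; rewrite r; lia.
Qed.

Lemma parity_eq0 X : parity X = 0 ->
  exists Z : int * 'rV[int]_n, X = Z + Z.
Proof.
case: X => q p [q0 p0].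
have [w ->] := intr_F2_eq0 q0.
have /choice[f fE] i : exists w, p 0 i = w + w.
  by apply: intr_F2_eq0; move/rowP/(_ i): p0; rewrite !mxE.
exists (w, \row_i f i); congr pair; apply/rowP => i.
by rewrite fE !mxE.
Qed.

Lemma card_parity : #|{: 'F_2 * 'rV['F_2]_n}| = (2 ^ n.+1)%N.
Proof. by rewrite card_prod card_mx card_Fp // mul1n expnS. Qed.

End ParityClasses.

(** * Remainders of lattice points *)

Section MinimalPoints.
Variables (R : realType) (n : nat) (dot : {dot 'rV[R]_n for idfun}).
Variable alpha : 'rV[R]_n.
Implicit Types (x y : 'rV[R]_n) (X Y Z : int * 'rV[int]_n).

(** The vector q alpha - p attached to the lattice point (q, p). *)
Definition remainder X : 'rV[R]_n := X.1%:~R *: alpha - intvec R X.2.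
(** Squared norm of the remainder. *)
Definition sqdist X : R := dot (remainder X) (remainder X).

(** A best approximation, as a lattice point: its remainder is strictly
    shorter than that of every point whose nonzero denominator is smaller in
    absolute value. *)
Definition minimal_point X :=
  0 < X.1 /\ forall Z, 0 < `|Z.1| < X.1 -> sqdist X < sqdist Z.

Lemma remainderD X Y : remainder (X + Y) = remainder X + remainder Y.
Proof.
rewrite /remainder /intvec /= rmorphD scalerDl map_mxD.
by rewrite opprD addrACA.
Qed.

Lemma remainderN X : remainder (- X) = - remainder X.
Proof. by rewrite /remainder /intvec /= rmorphN scaleNr map_mxN opprD. Qed.

Lemma dotC x y : dot x y = dot y x.
Proof. by rewrite (@hermitian_subproof _ _ _ _ dot x y) expr0 mul1r. Qed.

Lemma sqdist_ge0 X : 0 <= sqdist X.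
Proof.
rewrite /sqdist; have [->|x0] := eqVneq (remainder X) 0.
  by rewrite linear0l.
exact/ltW/(@neq0_dnorm_gt0 R _ idfun dot).
Qed.

Lemma sqdistN X : sqdist (- X) = sqdist X.
Proof. by rewrite /sqdist remainderN linearNl linearNr opprK. Qed.

Lemma dotDl x y z : dot (x + y) z = dot x z + dot y z.
Proof. exact: linearDl. Qed.

Lemma dotDr x y z : dot x (y + z) = dot x y + dot x z.
Proof. by rewrite dotC dotDl !(dotC x). Qed.

Lemma dotNr x y : dot x (- y) = - dot x y.
Proof. by rewrite dotC linearNl dotC. Qed.

Lemma dot_sqrD x y : dot (x + y) (x + y) = dot x x + dot y y + 2 * dot x y.
Proof. rewrite dotDl !dotDr (dotC y x); lra. Qed.

Lemma sqdistD X Y : sqdist (X + Y) =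
  sqdist X + sqdist Y + 2 * dot (remainder X) (remainder Y).
Proof. by rewrite /sqdist remainderD dot_sqrD. Qed.

Lemma dot_remainderD X Y Z : dot (remainder X) (remainder (Y + Z)) =
  dot (remainder X) (remainder Y) + dot (remainder X) (remainder Z).
Proof. by rewrite remainderD dotDr. Qed.

Lemma sqdistB X Y : sqdist (X - Y) =
  sqdist X + sqdist Y - 2 * dot (remainder X) (remainder Y).
Proof. by rewrite sqdistD sqdistN remainderN dotNr mulrN. Qed.

Lemma sqdist_double Z : sqdist (Z + Z) = 4 * sqdist Z.
Proof. by rewrite sqdistD -/(sqdist Z); lra. Qed.

(** Parallelogram law for the half-difference Z and the midpoint X + Z of X
    and Y. *)
Lemma sqdist_midpoints X Y Z : Y = X + (Z + Z) ->
  2 * (sqdist Z + sqdist (X + Z)) = sqdist X + sqdist Y.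
Proof.
move=> ->; rewrite !(sqdistD X) sqdist_double dot_remainderD; lra.
Qed.

(** The four vectors (x+y+z)/2, (y+z-x)/2, (x+z-y)/2, (x+y-z)/2 have the same
    total squared length as x, y, z. *)
Lemma sqdist_half_sum X Y Z W : X + Y + Z = W + W ->
  sqdist W + sqdist (W - X) + sqdist (W - Y) + sqdist (W - Z) =
  sqdist X + sqdist Y + sqdist Z.
Proof.
move=> e; have := congr1 (fun V => dot (remainder W) (remainder V)) e.
rewrite /= !dot_remainderD -/(sqdist W) !sqdistB; lra.
Qed.

Lemma sqdist_lt X Y : minimal_point X -> minimal_point Y -> X.1 < Y.1 ->
  sqdist Y < sqdist X.
Proof. by move=> [X0 _] [_ YP] XY; apply: YP; lia. Qed.

Lemma parity_neq0 X : minimal_point X -> parity X != 0.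
Proof.
move=> [X0 XP]; apply/eqP => /parity_eq0[Z XZ].
have X1 : X.1 = Z.1 + Z.1 by have := congr1 fst XZ.
have XE : sqdist X = 4 * sqdist Z by rewrite XZ sqdist_double.
have : sqdist X < sqdist Z by apply: (XP Z); lia.
have := sqdist_ge0 Z; lra.
Qed.

Lemma parity_eq_ge3 X Y : minimal_point X -> minimal_point Y ->
  X.1 < Y.1 -> parity X = parity Y -> 3 * X.1 <= Y.1.
Proof.
move=> Xm Ym XY e; have YX := sqdist_lt Xm Ym XY.
have /parity_eq0[W WE] : parity (X + Y) = 0.
  by rewrite parityD e parity_addrr.
(* W is the midpoint of X and Y, and W - X their half-difference *)
have YE : Y = X + ((W - X) + (W - X)).
  by rewrite addrACA -WE addrACA subrr add0r addrCA subrr addr0.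
have Z1 : X.1 + Y.1 = W.1 + W.1 by have := congr1 fst WE.
rewrite leNgt; apply/negP => YX3.
have [_ XP] := Xm; have dW : sqdist X < sqdist (W - X) by apply: XP => /=; lia.
have := sqdist_midpoints YE; have := sqdist_ge0 (X + (W - X)); lra.
Qed.

Lemma parity_sum_neq0 X Y Z : minimal_point X -> minimal_point Y ->
  minimal_point Z -> X.1 < Y.1 < Z.1 -> Z.1 - Y.1 < X.1 ->
  parity X + parity Y + parity Z != 0.
Proof.
move=> Xm Ym Zm /andP[XY YZ] ZY; apply/eqP; rewrite -!parityD.
move=> /parity_eq0[W WE].
have W1 : X.1 + Y.1 + Z.1 = W.1 + W.1 by have := congr1 fst WE.
have [X0 XP] := Xm; have [_ ZP] := Zm.
(* The denominators of W - X, W - Y, W - Z are (y+z-x)/2, (x+z-y)/2,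
   (x+y-z)/2; all are positive, the last because z - y < x. *)
have dX : sqdist Z < sqdist (W - X) by apply: ZP => /=; lia.
have dY : sqdist X < sqdist (W - Y) by apply: XP => /=; lia.
have dZ : sqdist X < sqdist (W - Z) by apply: XP => /=; lia.
have YX := sqdist_lt Xm Ym XY.
have := sqdist_half_sum WE; have := sqdist_ge0 W; lra.
Qed.

End MinimalPoints.

(** * Zero-sum triples in an elementary abelian 2-group *)

Section ZeroSumTriples.
Variables (G : finZmodType) (N : nat) (w : nat -> G).
Hypothesis addGG : forall x : G, x + x = 0.
Hypothesis cardG : #|G| = (4 * N)%N.
Hypothesis w_neq0 : forall i, (i <= 2 * N)%N -> w i != 0.
Hypothesis w_inj : forall i j, (i < j <= 2 * N)%N -> w i != w j.

Lemma addGK (x y : G) : x + y + y = x.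
Proof. by rewrite -addrA addGG addr0. Qed.

Lemma addG_swap (x y g h : G) : x + g = y + h -> x + y = g + h.
Proof.
by move=> e; rewrite -(addGK x g) e addrAC (addrAC y) addGG add0r addrC.
Qed.

Lemma w_inj_le i j : (i <= 2 * N)%N -> (j <= 2 * N)%N -> w i = w j -> i = j.
Proof.
move=> iN jN e; have [ij|ji|//] := ltngtP i j.
  by have := @w_inj i j; rewrite e eqxx ij jN => /(_ isT).
by have := @w_inj j i; rewrite e eqxx ji iN => /(_ isT).
Qed.

(** More than half of the group meets its own translate by [w 0]. *)
Lemma dependent_triple : exists a b c,
  [/\ (a <= 2 * N)%N, (b <= 2 * N)%N, (c <= 2 * N)%N & w a + w b = w c].
Proof.
pose f (u : bool * 'I_(2 * N).+1) : G := w u.2 + w 0 *+ u.1.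
have /injectivePn[[s i] [[t j] ne]] : ~~ injectiveb f.
  apply/negP => /injectiveP/leq_card.
  by rewrite card_prod card_bool card_ord cardG; lia.
have iN : (i <= 2 * N)%N by rewrite -ltnS.
have jN : (j <= 2 * N)%N by rewrite -ltnS.
case: s t ne => [] [] ne; rewrite /f /= ?mulr1n ?mulr0n ?addr0.
- by move=> /addIr/w_inj_le e; case/eqP: ne; congr pair; apply/val_inj/e.
- by exists i, 0%N, j.
- by exists j, 0%N, i.
- by move=> /w_inj_le e; case/eqP: ne; congr pair; apply/val_inj/e.
Qed.

(** The N+1 elements [w N], ..., [w (2 * N)] collide modulo the subgroup
    V = {0, w a, w b, w a + w b = w c}, which has N cosets. *)
Lemma upper_collision : exists t u x,
  [/\ (N <= t <= 2 * N)%N, (N <= u <= 2 * N)%N, (x <= 2 * N)%N, t <> u &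
      w t + w u = w x].
Proof.
have [a [b [c [aN bN cN abc]]]] := dependent_triple.
(* the pair of booleans runs over the four elements of V *)
pose f (u : 'I_N.+1 * (bool * bool)) : G :=
  w (N + u.1)%N + (w a *+ u.2.1 + w b *+ u.2.2).
have /injectivePn[[t [p q]] [[u [r s]] ne]] : ~~ injectiveb f.
  apply/negP => /injectiveP/leq_card.
  by rewrite !card_prod card_bool card_ord cardG; lia.
have tN : (t < N.+1)%N by [].
have uN : (u < N.+1)%N by [].
move=> /addG_swap; rewrite addrACA -!mulrnDr => e.
have [tu|tu] := eqVneq t u.
  (* two distinct pairs of booleans would then denote the same element of V *)
  move: e ne; rewrite tu addGG.
  have abc0 : w a + w b != 0 by rewrite abc w_neq0.
  have [a0 b0] := (w_neq0 aN, w_neq0 bN).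
  case: p q r s => [] [] [] [];
    rewrite /= ?mulr0n ?mulr1n ?mulr2n ?addGG ?add0r ?addr0 => /esym/eqP;
    by rewrite ?eqxx // ?(negPf abc0) ?(negPf a0) ?(negPf b0).
have wtu : w (N + t)%N + w (N + u)%N != 0.
  rewrite -(addGG (w (N + u)%N)) (inj_eq (addIr _)); apply/eqP => /w_inj_le.
  move=> h; case/eqP: tu; apply/val_inj => /=; lia.
have ntu : (N + t)%N <> (N + u)%N.
  by move=> h; case/eqP: tu; apply/val_inj => /=; lia.
suff [x xN xE] : exists2 x, (x <= 2 * N)%N & w (N + t)%N + w (N + u)%N = w x.
  by exists (N + t)%N, (N + u)%N, x; split=> //; lia.
move: wtu; rewrite e.
case: (p) (q) (r) (s) => [] [] [] [];
  rewrite /= ?mulr0n ?mulr1n ?mulr2n ?addGG ?add0r ?addr0 ?eqxx // => _;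
  by [exists a | exists b | exists c].
Qed.

Lemma upper_zero_sum_triple : exists i j k,
  [/\ (i < j < k)%N, (k <= 2 * N)%N, (N <= j)%N & w i + w j + w k = 0].
Proof.
have [t [u [x []]]] := upper_collision.
wlog tu : t u / (t < u)%N.
  move=> h tN uN xN tu e; have [tu'|ut|//] := ltngtP t u.
    exact: (h t u).
  by apply: (h u t) => //; [move=> e'; apply: tu | rewrite addrC].
move=> tN uN xN _ e.
have tuN : (t <= 2 * N)%N /\ (u <= 2 * N)%N by lia.
(* x = t or x = u would make the other one of w u, w t vanish *)
have xt : x <> t.
  move=> xt; move: e; rewrite xt -[RHS]addr0 => /addrI/eqP.
  by apply/negP/w_neq0; lia.
have xu : x <> u.
  move=> xu; move: e; rewrite xu -[RHS]add0r => /addIr/eqP.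
  by apply/negP/w_neq0; lia.
have s0 : w t + w u + w x = 0 by rewrite e addGG.
have [xt'|tx] := ltnP x t.
  by exists x, t, u; split=> //; [lia|lia|lia|rewrite -addrA addrC].
have [xu'|ux] := ltnP x u.
  by exists t, x, u; split=> //; [lia|lia|lia|rewrite addrAC].
by exists t, u, x; split=> //; lia.
Qed.
End ZeroSumTriples.

(** * The recurrence for best denominators *)

Section BestDenominators.
Variables (R : realType) (n : nat) (dot : {dot 'rV[R]_n for idfun}).
Variable alpha : 'rV[R]_n.

Lemma delta_le_sqdist (Z : int * 'rV[int]_n) : 0 < Z.1 ->
  delta dot alpha `|Z.1|%N <= Num.sqrt (sqdist dot alpha Z).
Proof.
move=> Z0; have [_ /(_ Z.2)] := delta_min dot alpha `|Z.1|%N.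
by rewrite /dotnorm /sqdist /remainder natr_absz gtr0_norm.
Qed.

Lemma best_denominator_point q : best_denominator dot alpha q ->
  exists2 X, X.1 = q%:Z & minimal_point dot alpha X.
Proof.
move=> [q0 qP]; have [[p pE] _] := delta_min dot alpha q.
exists (q%:Z, p) => //; split; first by rewrite /=; lia.
suff h (Z : int * 'rV[int]_n) : 0 < Z.1 < q%:Z ->
    sqdist dot alpha (q%:Z, p) < sqdist dot alpha Z.
  move=> Z Zq; have {}Zq : 0 < `|Z.1| < q%:Z := Zq.
  have [Z0|Z0] : 0 < Z.1 \/ Z.1 < 0 by lia.
    by apply: h; lia.
  by rewrite -(sqdistN _ _ Z); apply: h => /=; lia.
move=> Zq; rewrite ltNge; apply/negP => /ler_wsqrtr.
have Z0 : 0 < Z.1 by lia.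
have := qP `|Z.1|%N; rewrite pE => /(_ ltac:(lia)) lt1.
by move=> /(le_trans (delta_le_sqdist Z0)) /le_lt_trans/(_ lt1); rewrite ltxx.
Qed.

(** The indices are shifted by one because [bestq] is a best denominator only
    from index 1 on; [X i] and [w i] below belong to index m + i + 1. *)
Lemma bestq_recurrence m : (0 < n)%N -> ~ rational_rV alpha ->
  let N := (2 ^ n.-1)%N in let q := bestq dot alpha in
  (q (m + N).+1 + q m.+1 <= q (m + 2 * N).+1)%N \/
  (3 * q m.+1 <= q (m + 2 * N).+1)%N.
Proof.
move=> n0 irr N q.
have q_lt i j : (i < j)%N -> (q i < q j)%N by exact: bestq_increasing.
have /choice[X XP] i : exists X : int * 'rV[int]_n,
    X.1 = (q (m + i).+1)%:Z /\ minimal_point dot alpha X.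
  have [|X X1 Xm] := @best_denominator_point (q (m + i).+1); last by exists X.
  by rewrite -bestq_range //; exists (m + i).+1.
have X1 i : (X i).1 = (q (m + i).+1)%:Z by case: (XP i).
have Xm i : minimal_point dot alpha (X i) by case: (XP i).
have X_lt i j : (i < j)%N -> (X i).1 < (X j).1.
  by move=> ij; rewrite !X1 ltz_nat q_lt // ltnS ltn_add2l.
have q_le i j : (i <= j)%N -> (q (m + i).+1 <= q (m + j).+1)%N.
  rewrite leq_eqVlt => /orP[/eqP->//|ij]; apply/ltnW/q_lt.
  by rewrite ltnS ltn_add2l.
have [|h1] := leqP (q (m + N).+1 + q m.+1) (q (m + 2 * N).+1); first by left.
have [|h2] := leqP (3 * q m.+1) (q (m + 2 * N).+1); first by right.
exfalso; pose w i := parity (X i).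
have qm i : (q m.+1 <= q (m + i).+1)%N.
  by have := @q_le 0%N i; rewrite addn0; apply.
have [||||i [j [k [ijk kN Nj]]]] :=
    @upper_zero_sum_triple ('F_2 * 'rV['F_2]_n)%type N w.
- exact: parity_addrr.
- rewrite card_parity; have -> : n.+1 = (n.-1 + 2)%N by lia.
  by rewrite expnD mulnC.
- by move=> i _; exact: parity_neq0 (Xm i).
- move=> i j /andP[ij jN]; apply/eqP => /(parity_eq_ge3 (Xm i) (Xm j)).
  move=> /(_ (X_lt _ _ ij)); rewrite !X1.
  have := qm i; have := q_le _ _ jN; lia.
- move=> /eqP; apply/negP.
  move/andP: ijk => [ij jk].
  apply: (parity_sum_neq0 (Xm i) (Xm j) (Xm k)); first by rewrite !X_lt.
  rewrite !X1; have := qm i; have := q_le _ _ kN; have := q_le _ _ Nj; lia.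
Qed.

End BestDenominators.

(** * Exponential growth and lower limits *)

Section Growth.
Variable R : realType.

Lemma golden_ratio_sqr : golden_ratio R ^+ 2 = golden_ratio R + 1.
Proof.
have := @sqr_sqrtr R 5; rewrite /golden_ratio => /(_ ltac:(lra)).
set s := Num.sqrt 5 => s2; nra.
Qed.

Lemma golden_ratio_ge1 : 1 <= golden_ratio R.
Proof.
rewrite /golden_ratio ler_pdivlMr // mul1r -[2]/(1 + 1) lerD2l.
by rewrite -{1}(@sqrtr1 R) ler_wsqrtr // ler1n.
Qed.

Lemma golden_ratio_le2 : golden_ratio R <= 2.
Proof. have := golden_ratio_sqr; have := golden_ratio_ge1; nra. Qed.

Lemma fibonacci_growth (N : nat) (lam : R) (q : nat -> nat) :
  (0 < N)%N -> 1 <= lam -> lam ^+ N = golden_ratio R ->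
  (forall m, 0 < q m)%N ->
  (forall m, (q (m + N) + q m <= q (m + 2 * N))%N \/
             (3 * q m <= q (m + 2 * N))%N) ->
  forall m, lam ^+ m <= golden_ratio R ^+ 2 * (q m)%:R.
Proof.
move=> N0 lam1 lamN q0 qrec.
have g1 := golden_ratio_ge1; have g2 := golden_ratio_le2.
have gE := golden_ratio_sqr.
elim/ltn_ind => m IH; have [mN|Nm] := ltnP m (2 * N).
  (* base case: lam^m <= lam^(2N) = phi^2, whence the constant *)
  have : lam ^+ m <= lam ^+ (2 * N) by rewrite ler_weXn2l // ltnW.
  rewrite mulnC exprM lamN => h; apply: (le_trans h).
  by rewrite ler_peMr ?exprn_ge0 ?ler1n // (le_trans _ g1).
have mE : m = (m - 2 * N + 2 * N)%N by rewrite subnK.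
set l := (m - 2 * N)%N in mE.
have IH1 := IH l ltac:(lia); have IH2 := IH (l + N)%N ltac:(lia).
have lE : lam ^+ m = lam ^+ l * golden_ratio R ^+ 2.
  by rewrite mE exprD mulnC exprM lamN.
have lEN : lam ^+ (l + N) = lam ^+ l * golden_ratio R by rewrite exprD lamN.
have L0 : 0 <= lam ^+ l by rewrite exprn_ge0 // (le_trans _ lam1).
have [] := qrec l; rewrite -mE -(ler_nat R) ?natrD ?natrM => h.
  have : golden_ratio R ^+ 2 * ((q (l + N)%N)%:R + (q l)%:R) <=
      golden_ratio R ^+ 2 * (q m)%:R by rewrite ler_wpM2l // gE; lra.
  by rewrite lE; move: IH1 IH2; rewrite lEN !gE; lra.
have : (golden_ratio R + 1) * (3 * (q l)%:R) <=
    (golden_ratio R + 1) * (q m)%:R.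
  by rewrite ler_wpM2l //; lra.
have : lam ^+ l * (golden_ratio R + 1) <= lam ^+ l * 3.
  by rewrite ler_wpM2l //; lra.
by rewrite lE gE; move: IH1; rewrite gE; lra.
Qed.

Lemma limn_einf_ge (u : nat -> \bar R) (a : \bar R) :
  (\forall m \near \oo, a <= u m)%E -> (a <= limn_einf u)%E.
Proof.
move=> [M _ aM]; rewrite limn_einf_lim.
apply: lime_ge; first exact: is_cvg_einfs.
exists M => // k /= Mk; apply: le_ereal_inf_tmp => _ [p /= kp <-].
by apply: aM; exact: leq_trans kp.
Qed.

(** A multiplicative constant K is harmless: for each r < 1, K r^m <= 1 for
    large m, hence (r lam)^m <= q_m. *)
Lemma root_growth (lam K : R) (q : nat -> R) : 0 < lam -> 0 < K ->
  (forall m, 0 <= q m) -> (forall m, lam ^+ m.+1 <= K * q m.+1) ->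
  (lam%:E <= limn_einf (fun m => (q m `^ m%:R^-1)%:E))%E.
Proof.
move=> lam0 K0 q0 lamq; apply/lee_mul01Pr => [|r /andP[r0 r1]].
  by rewrite lee_fin ltW.
rewrite -EFinM; apply: limn_einf_ge.
have rK : \forall m \near \oo, r ^+ m <= K^-1.
  have r_cvg : GRing.exp r @ \oo --> (0 : R^o).
    by apply: cvg_expr; rewrite ger0_norm // ltW.
  have Kv0 : 0 < K^-1 by rewrite invr_gt0.
  move/cvgrPdist_le: r_cvg => /(_ _ Kv0); apply: filterS => m.
  by rewrite sub0r normrN ger0_norm // exprn_ge0 // ltW.
near=> m; rewrite lee_fin.
have m0 : (0 < m)%N by near: m; exact: nbhs_infty_gt.
have rm : r ^+ m <= K^-1 by near: m.
have mu0 : 0 <= r * lam by rewrite mulr_ge0 // ltW.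
have -> : r * lam = ((r * lam) ^+ m) `^ m%:R^-1.
  by rewrite -powR_mulrn // -powRrM mulfV ?powRr1 // pnatr_eq0 -lt0n.
apply: ge0_ler_powR; rewrite ?nnegrE ?invr_ge0 ?exprn_ge0 //.
have lm : lam ^+ m <= K * q m by have := lamq m.-1; rewrite prednK.
rewrite exprMn; apply: (@le_trans _ _ (K^-1 * (K * q m))).
  by apply: ler_pM rm lm; apply: exprn_ge0; exact: ltW.
by rewrite mulKf // gt_eqF.
Unshelve. all: by end_near.
Qed.

End Growth.

Theorem corollary1 (R : realType) (n : nat) (hn : (2 <= n)%N)
    (dot : {dot 'rV[R]_n for idfun}) :
  (forall alpha : 'rV[R]_n, ~ rational_rV alpha ->
     ((golden_ratio R `^ (1 / 2 ^+ (n - 1)%N))%:E <= growth dot alpha)%E) /\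
  ((golden_ratio R `^ (1 / 2 ^+ (n - 1)%N))%:E <= min_growth dot)%E.
Proof.
suff h (alpha : 'rV[R]_n) : ~ rational_rV alpha ->
    ((golden_ratio R `^ (1 / 2 ^+ (n - 1)%N))%:E <= growth dot alpha)%E.
  split=> //; rewrite /min_growth.
  by apply: le_ereal_inf_tmp => _ [alpha irr <-]; exact: h.
move=> irr; set lam := _ `^ _.
have g1 := golden_ratio_ge1 R; have g0 : 0 <= golden_ratio R by lra.
have lam1 : 1 <= lam.
  by rewrite -(powRr0 (golden_ratio R)) ler_powR // divr_ge0 // exprn_ge0.
have lamN : lam ^+ (2 ^ n.-1) = golden_ratio R.
  rewrite -powR_mulrn ?powR_ge0 // -powRrM natrX subn1.
  by rewrite mulfVK ?powRr1 // expf_neq0 // pnatr_eq0.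
pose q m := bestq dot alpha m.+1.
have q0 m : (0 < q m)%N.
  apply: (@leq_ltn_trans (bestq dot alpha 0%N)) => //.
  exact: bestq_increasing.
have qrec m := bestq_recurrence dot m (ltnW hn) irr.
have N0 : (0 < 2 ^ n.-1)%N by rewrite expn_gt0.
have qge := fibonacci_growth N0 lam1 lamN q0 qrec.
apply: (@root_growth R lam (lam * golden_ratio R ^+ 2)) => //.
- by lra.
- by rewrite mulr_gt0 ?exprn_gt0 //; lra.
- by move=> m; rewrite exprS -mulrA ler_wpM2l ?qge //; lra.
Qed.
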